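(* There exists a constant $\beta_1\in(0,1)$ such that if $s>1$ and $E\subset\mathbb{R}^N$ is compact, connected, $\mathcal{H}^s(E)<\infty$, $E$ is lower Ahlfors $s$-regular with constant $c$, and $$\beta_E\left(\overline{B}(x,r)\right)\leq\beta_1\quad\text{for all }x\in E\text{ and }0<r\leq\operatorname{diam}E,$$ then $E=f([0,1])$ for some injective $(1/s)$-Hölder continuous map $f:[0,1]\to\mathbb{R}^N$ with Hölder constant $H\lesssim_s c^{-1}\mathcal{H}^s(E)(\operatorname{diam}E)^{1-s}$.
   Context: $\mathcal{H}^s$ is $s$-dimensional Hausdorff measure on $\mathbb{R}^N$. $B(x,r)$ and $\overline{B}(x,r)$ are the open and closed balls of center $x$ and radius $r$. A set $E\subset\mathbb{R}^N$ is lower Ahlfors $s$-regular with constant $c$, where $0<c<\infty$, if $c\,r^s\leq\mathcal{H}^s(E\cap B(x,r))$ for all $x\in E$ and $0<r\leq\operatorname{diam}E$. For a nonempty set $E\subset\mathbb{R}^N$ and a bounded set $Q\subset\mathbb{R}^N$ of positive diameter, the Jones beta number is $$\beta_E(Q):=\inf_{\ell}\sup_{x\in E\cap Q}\frac{\operatorname{dist}(x,\ell)}{\operatorname{diam}Q}\in[0,1]$$ if $E\cap Q\neq\emptyset$, where $\ell$ ranges over all straight lines in $\mathbb{R}^N$, and $\beta_E(Q)=0$ if $E\cap Q=\emptyset$. A map $f:[0,1]\to\mathbb{R}^N$ is $(1/s)$-Hölder continuous with Hölder constant $H<\infty$ if $|f(x)-f(y)|\leq H|x-y|^{1/s}$ for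 all $x,y\in[0,1]$. The notation $a\lesssim_s b$ means that $a\leq Cb$ for some positive finite constant $C$ depending at most on $s$. *)

(* Defs.v *)
From mathcomp Require Import all_boot all_order all_algebra.
From mathcomp Require Import all_classical all_reals all_analysis.
Set Implicit Arguments.
Unset Strict Implicit.
Unset Printing Implicit Defensive.
Import Order.TTheory GRing.Theory Num.Theory numFieldNormedType.Exports.
Local Open Scope classical_set_scope.
Local Open Scope ring_scope.

(* R^N is 'rV[R]_N.  The library norm on row vectors is the sup norm: it
   induces the usual topology, so the library's [compact] and [connected] are
   the usual notions, but all metric notions below need the Euclidean norm. *)
Definition enorm (R : realType) (N : nat) (x : 'rV[R]_N) : R :=
  Num.sqrt (\sum_(i < N) x 0 i ^+ 2).

Definition eball (R : realType) (N : nat) (x : 'rV[R]_N) (r : R) :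
  set 'rV[R]_N := [set y | enorm (x - y) < r].

Definition ecball (R : realType) (N : nat) (x : 'rV[R]_N) (r : R) :
  set 'rV[R]_N := [set y | enorm (x - y) <= r].

(* The maximum with 0 only matters for the empty set, of diameter 0. *)
Definition diam (R : realType) (N : nat) (A : set 'rV[R]_N) : \bar R :=
  maxe 0%E (ereal_sup [set (enorm (x - y))%:E | x in A & y in A]).

Definition hausdorff_pre (R : realType) (N : nat) (s d : R)
    (E : set 'rV[R]_N) : \bar R :=
  ereal_inf [set (\sum_(0 <= i <oo) (diam (U i) `^ s))%E
            | U in [set U : nat -> set 'rV[R]_N |
                     (forall i, (diam (U i) <= d%:E)%E) /\
                     E `<=` \bigcup_i U i]].

(* Meant for 0 < s: for s = 0 an empty set of the cover would count for
   0 `^ 0 = 1.  No dimensional constant is put in front of the sum. *)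
Definition hausdorff_measure (R : realType) (N : nat) (s : R)
    (E : set 'rV[R]_N) : \bar R :=
  ereal_sup [set hausdorff_pre s d E | d in [set d : R | 0 < d]].

Definition lower_ahlfors_regular (R : realType) (N : nat) (s c : R)
    (E : set 'rV[R]_N) : Prop :=
  forall (x : 'rV[R]_N) (r : R), E x -> 0 < r -> (r%:E <= diam E)%E ->
    ((c * r `^ s)%:E <= hausdorff_measure s (E `&` eball x r))%E.

Definition straight_line (R : realType) (N : nat) (l : set 'rV[R]_N) : Prop :=
  exists a v : 'rV[R]_N, v != 0 /\ l = [set a + t *: v | t in [set: R]].

Definition edist_set (R : realType) (N : nat) (x : 'rV[R]_N)
    (l : set 'rV[R]_N) : \bar R :=
  ereal_inf [set (enorm (x - y))%:E | y in l].

Definition jones_beta (R : realType) (N : nat) (E Q : set 'rV[R]_N) : \bar R :=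
  if E `&` Q == set0 then 0%E
  else ereal_inf
    [set ereal_sup [set (edist_set x l / diam Q)%E | x in E `&` Q]
    | l in [set l : set 'rV[R]_N | straight_line l]].

Definition holder_on (R : realType) (N : nat) (D : set R) (a H : R)
    (f : R -> 'rV[R]_N) : Prop :=
  forall x y : R, D x -> D y -> enorm (f x - f y) <= H * `|x - y| `^ a.

(* Main.v *)
Require Import Defs.
From mathcomp Require Import all_boot all_order all_algebra.
From mathcomp Require Import all_classical all_reals all_analysis.
From mathcomp Require Import ring lra.
Import Order.TTheory GRing.Theory Num.Theory numFieldNormedType.Exports.
Local Open Scope classical_set_scope.
Local Open Scope ring_scope.
Set Implicit Arguments.
Unset Strict Implicit.
Unset Printing Implicit Defensive.

(** The set [E] is an arc, and it is parametrized by its own Hausdorff measure.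

    Order. Flatness at all scales says that, seen from a point [x] of [E], two
    points of [E] at comparable distances from [x] lie in nearly equal or in
    nearly opposite directions ([nearly_collinear]). Orienting the direction
    of [E] near [x] at the largest scale, and carrying the orientation down
    the dyadic scales, one splits [E] minus [x] into two sides. The choices at
    different points are coherent: [y] is on the positive side of [x] if and
    only if [x] is on the negative side of [y] ([exists_sides]). This follows
    by going down the scales, comparing two close points with a third one, a
    few times farther away, which exists because [E] is connected. Since sides
    are locally constant, connectedness also makes the relation transitive
    ([side_trans]), so that [E] is totally ordered. Two geometric facts are
    needed: between [p] and [q] there is a ball centered on [E], of radius
    comparable to the distance from [p] to [q] ([side_middle_ball]), and all
    points between [p] and [q] are near [p] ([side_interval]).

    Parameter. Let [phi p] be the measure of the part of [E] up to [p]. Sets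
    at positive distance have additive measure ([hausdorff_separated]), so the
    middle ball and lower regularity bound [phi q - phi p] below by a multiple
    of [c * enorm (p - q) `^ s]. Measures of balls centered at [p] tend to [0]
    with the radius ([hausdorff_no_atom]), so [phi] is continuous, and by
    connectedness its range is the whole interval from [0] to the measure of
    [E]. The inverse of [phi], rescaled to the unit interval, is the map sought
    ([holder_parametrization]): the lower bound makes [phi] injective and its
    inverse Hoelder continuous of exponent [s^-1]. *)

(** * Euclidean geometry of row vectors *)

Section Euclid.
Context {R : realType} {N : nat}.
Implicit Types (u v w x y z : 'rV[R]_N) (a b t : R).

(** The Euclidean inner product. *)
Definition dot u v : R := \sum_(i < N) u 0 i * v 0 i.

Lemma dotC u v : dot u v = dot v u.
Proof. by apply: eq_bigr => i _; rewrite mulrC. Qed.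

Lemma dotDl u v w : dot (u + v) w = dot u w + dot v w.
Proof. by rewrite -big_split; apply: eq_bigr => i _; rewrite mxE mulrDl. Qed.

Lemma dotZl t u v : dot (t *: u) v = t * dot u v.
Proof. by rewrite mulr_sumr; apply: eq_bigr => i _; rewrite mxE mulrA. Qed.

Lemma dotNl u v : dot (- u) v = - dot u v.
Proof. by rewrite -scaleN1r dotZl mulN1r. Qed.

Lemma dotDr u v w : dot w (u + v) = dot w u + dot w v.
Proof. by rewrite dotC dotDl !(dotC w). Qed.

Lemma dotZr t u v : dot v (t *: u) = t * dot v u.
Proof. by rewrite dotC dotZl (dotC v). Qed.

Lemma dotNr u v : dot v (- u) = - dot v u.
Proof. by rewrite dotC dotNl (dotC v). Qed.

Definition dotE := (dotDl, dotDr, dotNl, dotNr, dotZl, dotZr).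

Lemma dot_ge0 u : 0 <= dot u u.
Proof. by apply: sumr_ge0 => i _; rewrite -expr2 sqr_ge0. Qed.

Lemma dot_eq0 u : dot u u = 0 -> u = 0.
Proof.
move=> u0; apply/rowP => i; rewrite mxE; apply/eqP.
move/eqP: u0; rewrite psumr_eq0 => [/allP/(_ i)|j _]; last first.
  by rewrite -expr2 sqr_ge0.
by rewrite mem_index_enum => /(_ isT); rewrite /= mulf_eq0 orbb.
Qed.

Lemma dot_enorm u : dot u u = enorm u ^+ 2.
Proof.
rewrite sqr_sqrtr; last by apply: sumr_ge0 => i _; rewrite sqr_ge0.
by apply: eq_bigr => i _; rewrite expr2.
Qed.

Lemma enorm_ge0 u : 0 <= enorm u. Proof. exact: sqrtr_ge0. Qed.

Lemma enorm0_eq0 u : enorm u = 0 -> u = 0.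
Proof. by move=> u0; apply: dot_eq0; rewrite dot_enorm u0 expr0n. Qed.

Lemma enorm0 : enorm (0 : 'rV[R]_N) = 0.
Proof.
by apply/eqP; rewrite -sqrf_eq0 -dot_enorm -(scale0r 0) dotZl mul0r.
Qed.

Lemma enormN u : enorm (- u) = enorm u.
Proof. by rewrite /enorm; congr Num.sqrt; apply: eq_bigr => i _; rewrite mxE sqrrN. Qed.

Lemma enormB x y : enorm (x - y) = enorm (y - x).
Proof. by rewrite -enormN opprB. Qed.

Lemma enormZ t u : enorm (t *: u) = `|t| * enorm u.
Proof.
apply/eqP; rewrite -(@eqrXn2 _ 2) ?enorm_ge0 ?mulr_ge0 ?enorm_ge0//.
by rewrite exprMn -!dot_enorm !dotE mulrA real_normK ?num_real// expr2.
Qed.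

Lemma enorm_gt0 x y : x <> y -> 0 < enorm (x - y).
Proof.
move=> xy; rewrite lt_neqAle enorm_ge0 andbT eq_sym.
by apply/eqP => /enorm0_eq0/subr0_eq.
Qed.

Lemma cauchy_schwarz u v : dot u v ^+ 2 <= dot u u * dot v v.
Proof.
have [v0|vN0] := eqVneq (dot v v) 0.
  by rewrite (dot_eq0 v0) -(scale0r u) dotZr mul0r expr0n mulr_ge0 ?dot_ge0.
have v_gt0 : 0 < dot v v by rewrite lt_neqAle eq_sym vN0 dot_ge0.
rewrite -subr_ge0 -(pmulr_rge0 _ v_gt0).
have := dot_ge0 (dot v v *: u + - (dot u v *: v)).
rewrite !dotE (dotC v u); congr (0 <= _); ring.
Qed.

Lemma dot_le_enorm u v : dot u v <= enorm u * enorm v.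
Proof.
have [|/ltW uv0] := leP (dot u v) 0.
  by move/le_trans; apply; rewrite mulr_ge0 ?enorm_ge0.
rewrite -(@ler_pXn2r _ 2) ?nnegrE ?mulr_ge0 ?enorm_ge0//.
by rewrite exprMn -!dot_enorm cauchy_schwarz.
Qed.

Lemma enormD u v : enorm (u + v) <= enorm u + enorm v.
Proof.
rewrite -(@ler_pXn2r _ 2) ?nnegrE ?addr_ge0 ?enorm_ge0//.
rewrite -dot_enorm !dotE (dotC v u) sqrrD -!dot_enorm.
have := dot_le_enorm u v; lra.
Qed.

Lemma triangle x y z : enorm (x - z) <= enorm (x - y) + enorm (y - z).
Proof. by rewrite -[x - z](subrKA y); exact: enormD. Qed.

(** The law of cosines. *)
Lemma dot_cosine x y z : dot (y - x) (z - x) =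
  (enorm (y - x) ^+ 2 + enorm (z - x) ^+ 2 - enorm (y - z) ^+ 2) / 2.
Proof. by rewrite -!dot_enorm !dotE (dotC y x) (dotC z x) (dotC y z); field. Qed.

Lemma dot_swap x y z :
  dot (y - x) (z - x) + dot (x - y) (z - y) = enorm (x - y) ^+ 2.
Proof. by rewrite -dot_enorm !dotE (dotC y x); ring. Qed.

(** Sign rule: if the lines spanned by [u] and [v], and those spanned by
    [v] and [w], make an angle less than 45 degrees, then an even number
    of the three pairs of vectors point in opposite directions. *)
Lemma tri_sign u v w :
  dot u u * dot v v < 2 * dot u v ^+ 2 ->
  dot v v * dot w w < 2 * dot v w ^+ 2 ->
  0 < dot u v * dot v w * dot u w.
Proof.
move=> uv vw.
(* Cauchy-Schwarz for the components of [u] and [w] orthogonal to [v]. *)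
have cs := cauchy_schwarz (dot v v *: u + - (dot u v *: v))
             (dot v v *: w + - (dot v w *: v)).
rewrite !dotE (dotC v u) (dotC w v) in cs.
have := cauchy_schwarz v w; have := cauchy_schwarz u v.
move: cs uv vw (dot_ge0 u) (dot_ge0 v) (dot_ge0 w).
move: (dot u u) (dot v v) (dot w w) (dot u v) (dot v w) (dot u w).
move=> A B C P Q S cs uv vw A0 B0 C0 csP csQ.
have [B00|BN0] := eqVneq B 0; first by move: uv csP; rewrite B00 mulr0; lra.
have B_gt0 : 0 < B by rewrite lt_neqAle eq_sym BN0.
have cs' : (B * S - P * Q) ^+ 2 <= (A * B - P ^+ 2) * (B * C - Q ^+ 2).
  rewrite -(ler_pM2l B_gt0) -(ler_pM2l B_gt0).
  move: cs; congr (_ <= _); ring.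
have lt : (A * B - P ^+ 2) * (B * C - Q ^+ 2) < P ^+ 2 * Q ^+ 2.
  by apply: ltr_pM; rewrite ?subr_ge0//; lra.
rewrite -(pmulr_rgt0 _ B_gt0).
have := sqr_ge0 (B * S); have := le_lt_trans cs' lt; nra.
Qed.

(** The topology is that of the sup norm. *)
Lemma enorm_continuous : continuous (fun x : 'rV[R]_N => enorm x).
Proof.
move=> x; apply: (@continuous_comp _ _ _ _ Num.sqrt); last exact: sqrt_continuous.
apply: continuous_big => [|i _]; first exact: add_continuous.
move=> y; apply: (@continuous_comp _ _ _ (fun z : 'rV[R]_N => z 0 i) (fun a : R => a ^+ 2)).
  exact: coord_continuous.
exact: exprn_continuous.
Qed.

End Euclid.

(** * Hausdorff measure *)

Section Hausdorff.
Context {R : realType} {N : nat}.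
Implicit Types (A B : set 'rV[R]_N) (s d : R).
Local Open Scope ereal_scope.

Lemma diam_ge0 A : 0 <= diam A.
Proof. by rewrite /diam le_max lexx. Qed.

Lemma le_diam_enorm A x y : A x -> A y -> (enorm (x - y))%:E <= diam A.
Proof.
move=> Ax Ay; rewrite /diam le_max; apply/orP; right.
by apply: ereal_sup_ubound; exists x => //; exists y.
Qed.

Lemma diam_le A (b : R) : (0 <= b)%R ->
  (forall x y, A x -> A y -> (enorm (x - y) <= b)%R) -> diam A <= b%:E.
Proof.
move=> b0 Ab; rewrite /diam ge_max lee_fin b0/=.
by apply: ge_ereal_sup => _ [x Ax [y Ay <-]]; rewrite lee_fin Ab.
Qed.

Lemma diam_mono A B : A `<=` B -> diam A <= diam B.
Proof.
move=> AB; rewrite /diam ge_max diam_ge0/=; apply: ge_ereal_sup => _ [x Ax [y Ay <-]].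
by apply: le_diam_enorm; exact: AB.
Qed.

Lemma diam_set0 : diam (@set0 'rV[R]_N) = 0.
Proof. by apply/eqP; rewrite eq_le diam_ge0 andbT; exact: diam_le. Qed.

Lemma diam_set1 x : diam [set x : 'rV[R]_N] = 0.
Proof.
apply/eqP; rewrite eq_le diam_ge0 andbT; apply: diam_le => // _ _ -> ->.
by rewrite subrr enorm0.
Qed.

Lemma hausdorff_pre_ge0 s d A : 0 <= hausdorff_pre s d A.
Proof.
apply: le_ereal_inf_tmp => _ [U _ <-]; apply: nneseries_ge0 => *.
exact: poweR_ge0.
Qed.

Lemma hausdorff_pre_mono s d A B : A `<=` B ->
  hausdorff_pre s d A <= hausdorff_pre s d B.
Proof.
move=> AB; apply: ereal_inf_le_tmp => _ [U [Ud BU] <-].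
by exists U => //; split => //; exact: subset_trans BU.
Qed.

Lemma hausdorff_pre_anti s d d' A : (d <= d')%R ->
  hausdorff_pre s d' A <= hausdorff_pre s d A.
Proof.
move=> dd'; apply: ereal_inf_le_tmp => _ [U [Ud AU] <-].
by exists U => //; split => // i; apply: le_trans (Ud i) _; rewrite lee_fin.
Qed.

Lemma hausdorff_pre_le s d A : (0 < d)%R ->
  hausdorff_pre s d A <= hausdorff_measure s A.
Proof. by move=> d0; apply: ereal_sup_ubound; exists d. Qed.

Lemma hausdorff_ge0 s A : 0 <= hausdorff_measure s A.
Proof.
by apply: le_trans (hausdorff_pre_le _ _ ltr01); exact: hausdorff_pre_ge0.
Qed.

Lemma hausdorff_mono s A B : A `<=` B ->
  hausdorff_measure s A <= hausdorff_measure s B.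
Proof.
move=> AB; apply: ge_ereal_sup => _ [d /= d0 <-].
by apply: le_trans (hausdorff_pre_mono _ _ AB) _; exact: hausdorff_pre_le.
Qed.

(** The restriction on the diameters of the covering sets is absorbed into
    the gauge, so that [hausdorff_pre] is a Caratheodory outer measure. *)
Definition capped_gauge s d (U : set 'rV[R]_N) : \bar R :=
  if diam U <= d%:E then diam U `^ s else +oo.

Lemma capped_gauge_ge0 s d U : 0 <= capped_gauge s d U.
Proof. by rewrite /capped_gauge; case: ifP => // _; exact: poweR_ge0. Qed.

(* Every set is measurable for the sigma-algebra generated by all sets. *)
Let T : Type := g_sigma_algebraType [set: set 'rV[R]_N].

Lemma hausdorff_preE s d : hausdorff_pre s d =
  mu_ext (capped_gauge s d : set T -> \bar R).
Proof.
apply/funext => A; apply/eqP; rewrite eq_le; apply/andP; split.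
  apply: le_ereal_inf_tmp => _ [U [mU AU] <-].
  have [Ud|/existsNP[i /negP Uid]] := pselect (forall i, diam (U i) <= d%:E).
    apply: ereal_inf_lbound; exists U => //.
    by apply: eq_eseriesr => i _; rewrite /capped_gauge Ud.
  rewrite (@nneseries_pinfty _ _ _ i) ?leey//.
    by move=> *; exact: capped_gauge_ge0.
  by rewrite /capped_gauge (negbTE Uid).
apply: ereal_inf_le_tmp => _ [U [Ud AU] <-]; exists U.
  by split => // i; exact: sub_gen_smallest.
by apply: eq_eseriesr => i _; rewrite /capped_gauge Ud.
Qed.

Lemma hausdorff_pre_sigma_subadditive s d :
  sigma_subadditive (hausdorff_pre s d : set 'rV[R]_N -> \bar R).
Proof.
rewrite hausdorff_preE.
exact: (@mu_ext_sigma_subadditive _ T R _ (capped_gauge_ge0 s d)).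
Qed.

Lemma hausdorff_sigma_subadditive s :
  sigma_subadditive (hausdorff_measure s : set 'rV[R]_N -> \bar R).
Proof.
move=> A; apply: ge_ereal_sup => _ [d /= d0 <-].
apply: le_trans (hausdorff_pre_sigma_subadditive _ _ _) _.
by apply: lee_nneseries => [i _ _|i _]; [exact: hausdorff_pre_ge0|exact: hausdorff_pre_le].
Qed.

Lemma hausdorff_null s A : (0 < s)%R -> diam A = 0 -> hausdorff_measure s A = 0.
Proof.
move=> s0 A0; apply/eqP; rewrite eq_le hausdorff_ge0 andbT.
apply: ge_ereal_sup => _ [d /= d0 <-]; apply: ereal_inf_lbound.
exists (fun=> A).
  by split => [i|x Ax]; [rewrite A0 lee_fin ltW|exists 0%N].
by rewrite eseries0// => i _ _; rewrite A0 poweR0r// gt_eqF.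
Qed.

Lemma hausdorffU s A B : (0 < s)%R ->
  hausdorff_measure s (A `|` B) <= hausdorff_measure s A + hausdorff_measure s B.
Proof.
move=> s0; rewrite -bigcup2E; apply: le_trans (hausdorff_sigma_subadditive _ _) _.
rewrite (@nneseries_split _ _ 0 2); last by move=> *; exact: hausdorff_ge0.
rewrite eseries0 ?adde0; last first.
  by move=> [|[|i]]// _ _; rewrite /bigcup2 /= hausdorff_null// diam_set0.
by rewrite /= big_mkord !big_ord_recl big_ord0 /= adde0.
Qed.

(** Positively separated sets: no set of small diameter meets both. *)
Lemma hausdorff_separated s (e : R) A B : (0 < s)%R -> (0 < e)%R ->
  (forall x y, A x -> B y -> (e <= enorm (x - y))%R) ->
  hausdorff_measure s A + hausdorff_measure s B <= hausdorff_measure s (A `|` B).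
Proof.
move=> s0 e0 sep.
have pre d : (d < e)%R ->
    hausdorff_pre s d A + hausdorff_pre s d B <= hausdorff_pre s d (A `|` B).
  move=> de; apply: le_ereal_inf_tmp => _ [U [Ud ABU] <-].
  apply: (@le_trans _ _ (\sum_(0 <= i <oo) diam (U i `&` A) `^ s +
                         \sum_(0 <= i <oo) diam (U i `&` B) `^ s)).
    apply: leeD; apply: ereal_inf_lbound.
      exists (fun i => U i `&` A) => //; split => [i|x Ax].
        exact: le_trans (diam_mono (@subIsetl _ _ _)) (Ud i).
      by have [i _ Uix] := ABU x (or_introl Ax); exists i.
    exists (fun i => U i `&` B) => //; split => [i|x Bx].
      exact: le_trans (diam_mono (@subIsetl _ _ _)) (Ud i).
    by have [i _ Uix] := ABU x (or_intror Bx); exists i.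
  rewrite -nneseriesD; [|by move=> *; exact: poweR_ge0..].
  apply: lee_nneseries => [i _ _|i _]; first by rewrite adde_ge0// poweR_ge0.
  have mono C : diam (U i `&` C) `^ s <= diam (U i) `^ s.
    have := diam_mono (@subIsetl _ (U i) C).
    by apply: gt0_ler_poweR; rewrite ?ltW// in_itv/= diam_ge0 leey.
  have [->|/set0P[x [Ux Ax]]] := eqVneq (U i `&` A) set0.
    by rewrite diam_set0 poweR0r ?gt_eqF// add0e mono.
  have [->|/set0P[y [Uy By]]] := eqVneq (U i `&` B) set0.
    by rewrite diam_set0 poweR0r ?gt_eqF// adde0 mono.
  have := le_trans (le_diam_enorm Ux Uy) (Ud i); rewrite lee_fin.
  by move=> /le_lt_trans/(_ de); rewrite ltNge sep.
have step d d' : (0 < d)%R -> (0 < d')%R ->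
    hausdorff_pre s d A + hausdorff_pre s d' B <= hausdorff_measure s (A `|` B).
  move=> d0 d'0; pose m := Num.min (Num.min d d') (e / 2)%R.
  have m0 : (0 < m)%R by rewrite !lt_min d0 d'0 divr_gt0.
  apply: le_trans (hausdorff_pre_le _ _ m0); apply: le_trans (pre m _).
    by apply: leeD; apply: hausdorff_pre_anti; rewrite !ge_min lexx ?orbT.
  by rewrite gt_min; apply/orP; right; rewrite ltr_pdivrMr// ltr_pMr// ltr1n.
have [->|fin] := eqVneq (hausdorff_measure s (A `|` B)) +oo; first exact: leey.
have hfin C : C `<=` A `|` B -> hausdorff_measure s C \is a fin_num.
  move=> /(hausdorff_mono s) CAB; rewrite ge0_fin_numE ?hausdorff_ge0//.
  by apply: le_lt_trans CAB _; rewrite ltey.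
rewrite addeC -leeBrDr ?hfin//; apply: ge_ereal_sup => _ [d' /= d'0 <-].
rewrite leeBrDr ?hfin// addeC.
have pfin : hausdorff_pre s d' B \is a fin_num.
  rewrite ge0_fin_numE ?hausdorff_pre_ge0//.
  apply: le_lt_trans (hausdorff_pre_le _ _ d'0) _.
  by rewrite -ge0_fin_numE ?hausdorff_ge0 ?hfin.
rewrite -leeBrDr//; apply: ge_ereal_sup => _ [d /= d0 <-].
by rewrite leeBrDr// step.
Qed.

End Hausdorff.

Lemma pow2_small (R : realType) (e : R) : 0 < e -> exists n, 1 / 2 ^+ n < e.
Proof.
move=> e0; have [n _] := near_infty_natSinv_expn_lt (PosNum e0).
by move=> /(_ n (leqnn n)) /= ?; exists n.
Qed.

Section NoAtoms.
Context {R : realType} {N : nat}.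
Implicit Types (E : set 'rV[R]_N) (s : R) (p : 'rV[R]_N).
Local Open Scope ereal_scope.

Let r (n : nat) : R := (1 / 2 ^+ n)%R.

Let r_gt0 n : (0 < r n)%R.
Proof. by rewrite divr_gt0 ?exprn_gt0. Qed.

Let rS n : (r n = 2 * r n.+1)%R.
Proof.
rewrite /r exprS invfM mulrCA !mul1r -[LHS]mul1r.
by rewrite mulrA divff ?mul1r// pnatr_eq0.
Qed.

Let r_le m n : (m <= n)%N -> (r n <= r m)%R.
Proof.
move=> /subnK <-; elim: (n - m)%N => [|k]//; apply: le_trans.
by rewrite addSn (rS (k + m)); have := r_gt0 (k + m).+1; lra.
Qed.

Let annulus E p n := E `&` [set y | (r n.+1 < enorm (p - y) <= r n)%R].

Let ball_annuli E p m : E `&` ecball p (r m) `<=`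
  [set p] `|` \bigcup_n annulus E p (m + n).
Proof.
move=> y [Ey /= ym]; have [->|/eqP yp] := eqVneq y p; first by left.
right; have t0 : (0 < enorm (p - y))%R by apply: enorm_gt0 => /esym.
have ex : exists n, (r (m + n).+1 < enorm (p - y))%R.
  have [n rn] := pow2_small t0; exists n; apply: le_lt_trans rn.
  by apply: r_le; rewrite -addnS (leq_trans (leqnSn n))// leq_addl.
case: (ex_minnP ex) => n rn nmin; exists n => //; split => //=; rewrite rn/=.
case: n => [|n] in rn nmin *; first by rewrite addn0.
by rewrite leNgt addnS; apply/negP => /nmin; rewrite ltnn.
Qed.

(** A set of finite Hausdorff measure charges no point: alternate annuli
    about the point are separated, so their measures are summable. *)
Lemma hausdorff_no_atom s E p (e : R) : (0 < s)%R -> (0 < e)%R ->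
  hausdorff_measure s E < +oo ->
  exists2 rho : R, (0 < rho)%R & hausdorff_measure s (E `&` ecball p rho) < e%:E.
Proof.
move=> s0 e0 Efin.
have fin C : C `<=` E -> hausdorff_measure s C \is a fin_num.
  move=> /(hausdorff_mono s) CE; rewrite ge0_fin_numE ?hausdorff_ge0//.
  exact: le_lt_trans CE Efin.
pose h n := fine (hausdorff_measure s (E `&` ecball p (r n))).
pose a n := fine (hausdorff_measure s (annulus E p n)).
have hE n : hausdorff_measure s (E `&` ecball p (r n)) = (h n)%:E.
  by rewrite fineK// fin//; exact: subIsetl.
have aE n : hausdorff_measure s (annulus E p n) = (a n)%:E.
  by rewrite fineK// fin//; exact: subIsetl.
have ah n : (a n + h n.+2 <= h n)%R.
  rewrite -lee_fin EFinD -aE -!hE.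
  apply: (@le_trans _ _ (hausdorff_measure s (annulus E p n `|`
                           (E `&` ecball p (r n.+2))))).
    apply: (@hausdorff_separated _ _ _ (r n.+2)) => // x y [_ /= /andP[xn _]] [_ /= yn].
    by have := triangle p y x; rewrite /ecball /= in yn; rewrite (enormB y x); have := rS n.+1; lra.
  apply: hausdorff_mono => x [[Ex /= /andP[_ xn]]|[Ex /= xn]]; split => //.
  by apply: (le_trans (xn : enorm (p - x) <= _)%R); exact/r_le/leqW.
have sum_a m k :
    (\sum_(i < k) a (m + i)%N <= h m + h m.+1 - h (m + k)%N - h (m + k).+1)%R.
  elim: k => [|k IH]; first by rewrite big_ord0 addn0; lra.
  by rewrite big_ord_recr/= addnS; have := ah (m + k)%N; lra.
apply: contrapT => noe.
have h_ge n : (e <= h n)%R.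
  rewrite leNgt; apply/negP => hne; apply: noe; exists (r n); first exact: r_gt0.
  by rewrite hE lte_fin.
(* The sum of the measures of the annuli telescopes: if all the [h n] are at
   least [b], it is at most [h m + h m.+1 - 2 * b], whereas it is at least
   [h m]. *)
have double (b : R) : (forall n, b <= h n)%R -> (forall n, 2 * b <= h n)%R.
  move=> bh.
  have hS m : (2 * b <= h m.+1)%R.
    have : (h m)%:E <= (h m + h m.+1 - 2 * b)%:E.
      rewrite -hE; apply: le_trans (hausdorff_mono _ (@ball_annuli E p m)) _.
      apply: le_trans (hausdorffU _ _ s0) _.
      rewrite hausdorff_null ?diam_set1// add0e.
      apply: le_trans (hausdorff_sigma_subadditive _ _) _.
      apply: lime_le; first by apply: is_cvg_nneseries => *; exact: hausdorff_ge0.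
      near=> k; under eq_bigr do rewrite aE.
      rewrite sumEFin lee_fin big_mkord; apply: le_trans (sum_a m k) _.
      by have := bh (m + k)%N; have := bh (m + k).+1; lra.
    by rewrite lee_fin; lra.
  case=> [|n]; last exact: hS.
  apply: le_trans (hS 0%N) _; rewrite -lee_fin -!hE; apply: hausdorff_mono.
  by move=> x [Ex xn]; split => //; apply: (le_trans (xn : enorm (p - x) <= _)%R); exact: r_le.
have pow k : (forall n, 2 ^+ k * e <= h n)%R.
  elim: k => [|k IH]; first by move=> n; rewrite expr0 mul1r.
  by rewrite exprS -mulrA; exact: double.
have h1 : (0 < h 0 + 1)%R by rewrite ltr_wpDl// (le_trans (ltW e0)).
have [k] := pow2_small (divr_gt0 e0 h1).
rewrite /r mul1r ltr_pdivlMr// mulrC ltr_pdivrMr ?exprn_gt0// mulrC.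
by have := pow k 0%N; lra.
Unshelve. all: by end_near. Qed.

End NoAtoms.

(** * Flatness *)

Section Flatness.
Context {R : realType} {N : nat}.
Implicit Types (E : set 'rV[R]_N) (a b v p q x : 'rV[R]_N).

(** Two segments with endpoints in [E], lying in a ball centered on [E] and
    whose lengths are comparable to its radius, make an angle less than 45
    degrees, up to orientation. The factor 50 leaves room for all the ratios
    of lengths, at most 48, that occur in the construction of the sides. *)
Definition nearly_collinear E : Prop :=
  forall x (r : R) p q p' q', E x -> E p -> E q -> E p' -> E q' -> 0 < r ->
    enorm (x - p) <= r -> enorm (x - q) <= r ->
    enorm (x - p') <= r -> enorm (x - q') <= r ->
    r <= 50 * enorm (p - q) -> r <= 50 * enorm (p' - q') ->
    dot (q - p) (q - p) * dot (q' - p') (q' - p') <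
      2 * dot (q - p) (q' - p') ^+ 2.

(** The Gram determinant is small for two vectors close to the same line; [h]
    bounds the distances to the line and [m] the lengths. *)
Lemma gram_tube a b v (t t' h m : R) :
  enorm (a - t *: v) <= h -> enorm (b - t' *: v) <= h ->
  enorm a <= m -> enorm b <= m ->
  dot a a * dot b b - dot a b ^+ 2 <= 4 * m ^+ 2 * h ^+ 2.
Proof.
wlog tt' : a b t t' / `|t'| <= `|t|.
  move=> wl ah bh am bm; have [tt'|/ltW tt'] := leP `|t'| `|t|.
    exact: (wl a b t t').
  by rewrite mulrC dotC; exact: (wl b a t' t).
move=> ah bh am _; have h0 := le_trans (enorm_ge0 _) ah.
have m0 := le_trans (enorm_ge0 _) am.
(* If [t = 0] then [t' = 0] and [l = 0]. *)
pose l := t' / t; have l1 : `|l| <= 1.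
  have [t0|tN0] := eqVneq t 0; first by rewrite /l t0 invr0 mulr0 normr0.
  by rewrite /l normrM normfV ler_pdivrMr ?normr_gt0// mul1r.
have lt : t' = l * t.
  have [t0|tN0] := eqVneq t 0; last by rewrite /l divfK.
  by move: tt'; rewrite t0 normr0 normr_le0 mulr0 => /eqP.
have bla : enorm (b - l *: a) <= 2 * h.
  have -> : b - l *: a = (b - t' *: v) + (- l) *: (a - t *: v).
    by rewrite lt; apply/rowP => i; rewrite !mxE; ring.
  apply: le_trans (enormD _ _) _; rewrite enormZ normrN.
  have := ler_pM (normr_ge0 l) (enorm_ge0 (a - t *: v)) l1 ah; lra.
have -> : dot a a * dot b b - dot a b ^+ 2 =
    dot a a * dot (b - l *: a) (b - l *: a) - dot a (b - l *: a) ^+ 2.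
  by rewrite !dotE (dotC b a); ring.
apply: (@le_trans _ _ (dot a a * dot (b - l *: a) (b - l *: a))).
  by rewrite lerBlDr lerDl sqr_ge0.
have -> : 4 * m ^+ 2 * h ^+ 2 = m ^+ 2 * (2 * h) ^+ 2 by ring.
rewrite !dot_enorm; apply: ler_pM; rewrite ?sqr_ge0//.
  by rewrite ler_pXn2r ?nnegrE ?enorm_ge0.
by rewrite ler_pXn2r ?nnegrE ?enorm_ge0// mulr_ge0.
Qed.

(** When [w = 0], the hypothesis on the quotient forces [u = 0]. *)
Lemma lte_div_le (u w : \bar R) (b e : R) : (0 <= u)%E -> (0 <= w)%E ->
  (w <= b%:E)%E -> 0 < b -> 0 < e ->
  (u / w < e%:E)%E -> (u < (e * b)%:E)%E.
Proof.
move=> u0; case: w => [w| |]//; rewrite !lee_fin => w0 wb b0 e0.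
have [->|wN0] := eqVneq w 0.
  rewrite inve0; move: u0; rewrite le_eqVlt => /predU1P[<-|u0].
    by rewrite lte_fin mulr_gt0.
  by rewrite gt0_muley.
have w_gt0 : 0 < w by rewrite lt_neqAle eq_sym wN0.
rewrite inver (negbTE wN0) lte_pdivrMr// => /lt_le_trans; apply.
by rewrite -EFinM lee_fin ler_pM2l.
Qed.

(** An almost optimal line in the definition of the Jones beta number. *)
Lemma jones_beta_tube E x (r b e : R) : E x -> 0 < r -> 0 <= b -> b < e ->
  (jones_beta E (ecball x r) <= b%:E)%E ->
  exists a v, forall y, E y -> enorm (x - y) <= r ->
    exists t, enorm (y - (a + t *: v)) <= 2 * e * r.
Proof.
move=> Ex r0 b0 be; rewrite /jones_beta; case: ifPn => [/eqP E0|_].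
  have : (E `&` ecball x r) x by split => //; rewrite /ecball /= subrr enorm0 ltW.
  by rewrite E0.
move=> /le_lt_trans-/(_ e%:E); rewrite lte_fin => /(_ be).
move=> /ereal_inf_lt[_ [_ [a [v [_ ->]]] <-] supe].
exists a, v => y Ey xy.
have : (edist_set y [set (a + t *: v)%R | t in [set: R]] < (e * (2 * r))%:E)%E.
  apply: (@lte_div_le _ (diam (ecball x r))).
  - by apply: le_ereal_inf_tmp => _ [z _ <-]; rewrite lee_fin enorm_ge0.
  - exact: diam_ge0.
  - apply: diam_le => [|z z' xz xz']; first by rewrite mulr_ge0// ltW.
    have := triangle z x z'; rewrite (enormB z x).
    by rewrite /ecball /= in xz xz'; lra.
  - by rewrite mulr_gt0.
  - exact: le_lt_trans be.
  - by apply: le_lt_trans supe; apply: ereal_sup_ubound; exists y.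
move=> /ereal_inf_lt[_ [_ [t _ <-] <-]]; rewrite lte_fin => /ltW yt.
by exists t; apply: le_trans yt _; rewrite le_eqVlt; apply/orP; left; apply/eqP; ring.
Qed.

Lemma flat_nearly_collinear E (D b : R) : 0 < D -> 0 < b ->
  1000 * (1000 * b) <= 1 ->
  (forall x y, E x -> E y -> enorm (x - y) <= D) ->
  (forall x (r : R), E x -> 0 < r -> r <= D ->
     (jones_beta E (ecball x r) <= b%:E)%E) ->
  nearly_collinear E.
Proof.
move=> D0 b0 b1 ED flat x r0 p q p' q' Ex Ep Eq Ep' Eq' r00 xp xq xp' xq' pq pq'.
(* Flatness is only assumed for radii up to [D]; a larger ball about [x]
   contains nothing more of [E]. *)
pose r := Num.min r0 D; have r_gt0 : 0 < r by rewrite lt_min r00.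
have rr0 : r <= r0 by rewrite ge_min lexx.
have le_r y : E y -> enorm (x - y) <= r0 -> enorm (x - y) <= r.
  by move=> Ey xy; rewrite le_min xy ED.
have {xp xq xp' xq'} [xp xq xp' xq'] : [/\ enorm (x - p) <= r, enorm (x - q) <= r,
  enorm (x - p') <= r & enorm (x - q') <= r] by split; exact: le_r.
have be : b < 10 * b by lra.
have rD : r <= D by rewrite ge_min lexx orbT.
have [a [v tube]] := jones_beta_tube Ex r_gt0 (ltW b0) be (flat x r Ex r_gt0 rD).
have segment y z : E y -> E z -> enorm (x - y) <= r -> enorm (x - z) <= r ->
    (exists t, enorm ((z - y) - t *: v) <= 40 * b * r) /\ enorm (z - y) <= 2 * r.
  move=> Ey Ez xy xz; split; last first.
    by have := triangle z x y; rewrite (enormB z x); lra.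
  have [t yt] := tube y Ey xy; have [t' zt] := tube z Ez xz; exists (t' - t).
  have -> : z - y - (t' - t) *: v = (z - (a + t' *: v)) + - (y - (a + t *: v)).
    by apply/rowP => i; rewrite !mxE; ring.
  by apply: le_trans (enormD _ _) _; rewrite enormN; lra.
have [[t pqt] pq2] := segment p q Ep Eq xp xq.
have [[t' pqt'] pq2'] := segment p' q' Ep' Eq' xp' xq'.
have := gram_tube pqt pqt' pq2 pq2'.
have sq_le (y z : 'rV[R]_N) : r <= 50 * enorm (y - z) -> r ^+ 2 <= 50 * 50 * dot (z - y) (z - y).
  move=> yz; rewrite dot_enorm -(enormB y) -expr2 -exprMn.
  by rewrite ler_pXn2r ?nnegrE ?mulr_ge0 ?enorm_ge0// ltW.
have := sq_le _ _ (le_trans rr0 pq); have := sq_le _ _ (le_trans rr0 pq').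
have r2 : 0 < r ^+ 2 by rewrite exprn_gt0.
have kb : (50 * 50 * b) ^+ 2 <= (1 / 400) ^+ 2.
  by rewrite ler_pXn2r// ?nnegrE; lra.
have -> : 4 * (2 * r) ^+ 2 * (40 * b * r) ^+ 2 =
    160 * 160 * b ^+ 2 * (r ^+ 2 * r ^+ 2) by ring.
move: r2 kb; rewrite exprMn.
move: (r ^+ 2) (b ^+ 2) (dot (q - p) (q - p)) (dot (q' - p') (q' - p')) (dot _ _ ^+ 2).
move=> X Y A B P X0 kb XB XA gram.
have XAB : X * X <= (50 * 50 * A) * (50 * 50 * B).
  by apply: ler_pM => //; exact: ltW.
have AB0 : 0 < A * B by have := mulr_gt0 X0 X0; lra.
nra.
Qed.

End Flatness.

(** * Connected and compact sets *)

Section Connected.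
Context {R : realType} {N : nat}.
Implicit Types (E : set 'rV[R]_N) (x y : 'rV[R]_N).

Lemma eball_open x (e : R) : open (eball x e).
Proof.
rewrite (_ : eball x e = (fun y => enorm (x - y)) @^-1` [set t | t < e])//.
apply: open_comp => [y _|]; last exact: open_lt.
apply: (@continuous_comp _ _ _ (fun y => x - y)); last exact: enorm_continuous.
by apply: continuousB; [exact: cst_continuous|exact: id].
Qed.

(** A locally constant predicate on a connected set is constant. *)
Lemma connected_locally_constant E (P : 'rV[R]_N -> Prop) : connected E ->
  (forall x, E x -> exists2 e : R, 0 < e &
     forall y, E y -> enorm (x - y) < e -> (P y <-> P x)) ->
  (exists2 x, E x & P x) -> forall x, E x -> P x.
Proof.
move=> Ec loc [x0 Ex0 Px0].
pose U Q := \bigcup_(B in [set B | exists x e,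
  B = eball x e /\ forall y, E y -> enorm (x - y) < e -> Q y]) B.
have Uo Q : open (U Q).
  by apply: bigcup_open => _ [x [e [-> _]]]; exact: eball_open.
have UE Q y : E y -> U Q y -> Q y.
  by move=> Ey [_ [x [e [-> Qxe]] xy]]; exact: Qxe.
have EU (Q : 'rV[R]_N -> Prop) x : (forall y, P y <-> P x -> Q y) -> E x -> U Q x.
  move=> PQ Ex; have [e e0 xe] := loc x Ex; exists (eball x e).
    by exists x, e; split => // y Ey xy; apply: PQ; exact: xe.
  by rewrite /eball /= subrr enorm0.
have EP x : E x /\ P x <-> E x /\ U P x.
  split=> -[Ex Px]; split => //; last exact: UE.
  by apply: EU => // y [_]; exact.
have -> // : E = E `&` P; last by move=> x [].
apply/esym/Ec; first by exists x0.
  exists (U P) => //; apply/seteqP; split => x; exact: (EP x).1 || exact: (EP x).2.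
exists (~` U (fun y => ~ P y)); first exact/open_closedC.
apply/seteqP; split => x [Ex Px]; split => //.
  by move=> /UE; exact.
by apply: contrapT => nPx; apply: Px; apply: EU => // y [yx _] /yx.
Qed.

Lemma compact_enorm_bounded E : compact E ->
  exists M : R, forall x y, E x -> E y -> enorm (x - y) <= M.
Proof.
move=> Ecpt; have [->|/set0P E0] := eqVneq E set0; first by exists 0.
have [c _ cmax] : exists2 c, c \in E & forall t, t \in E -> enorm t <= enorm c.
  apply: compact_EVT_max => //; apply: continuous_subspaceT.
  exact: enorm_continuous.
exists (enorm c + enorm c) => x y Ex Ey; apply: le_trans (enormD _ _) _.
by rewrite enormN; apply: lerD; apply: cmax; rewrite inE.
Qed.

End Connected.

(** * The two sides of a point *)

(** Given [x], [y] and [z], let [A] and [B] say that [y], respectively [z], is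
    on the chosen side of [x]; [C] and [F] that [x], respectively [z], is on
    that of [y]; [G] and [H] that [x], respectively [y], is on that of [z].
    Then [P] and [Q] say that [y] and [z] are on the same side of [x], and
    [x] and [z] on the same side of [y]. *)
Lemma side_switch (A B C F G H P Q : Prop) : (G <-> H) -> (P <-> ~ Q) ->
  ((A <-> B) <-> P) -> ((C <-> F) <-> Q) -> (B <-> ~ G) -> (F <-> ~ H) ->
  (A <-> ~ C).
Proof.
case: (pselect A) (pselect B) (pselect C) (pselect F) => ? [] ? [] ? [] ?;
  case: (pselect G) (pselect H) => ? [] ?; tauto.
Qed.

Section SidesDef.
Context {R : realType} {N : nat}.
Implicit Types (E : set 'rV[R]_N) (x y z : 'rV[R]_N).

Lemma nearly_collinear3 E x y z : nearly_collinear E -> E x -> E y -> E z -> x <> y ->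
  enorm (x - y) <= 4 * enorm (x - z) -> enorm (x - z) <= 4 * enorm (x - y) ->
  dot (y - x) (y - x) * dot (z - x) (z - x) < 2 * dot (y - x) (z - x) ^+ 2.
Proof.
move=> E_nc Ex Ey Ez /enorm_gt0 xy0 yz zy.
have z0 := enorm_ge0 (x - z).
by apply: (E_nc x (4 * enorm (x - y))) => //;
  rewrite ?subrr ?enorm0; lra.
Qed.

(** A choice, at every point [x] of [E], of one of the two sides of [x] in
    [E]: [side x y] says that [y] lies on it. The choices are coherent, in
    that [y] is on the chosen side of [x] if and only if [x] is on the other
    side of [y]; and points at comparable distances from [x] are on the same
    side when they are seen from [x] under an acute angle. *)
Record sides E (side : 'rV[R]_N -> 'rV[R]_N -> Prop) : Prop := Sides {
  side_irrefl : forall x, ~ side x x;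
  side_antisym : forall x y, E x -> E y -> x <> y ->
    (side x y <-> ~ side y x);
  side_dot : forall x y z, E x -> E y -> E z -> x <> y ->
    enorm (x - y) <= 4 * enorm (x - z) -> enorm (x - z) <= 4 * enorm (x - y) ->
    (side x y <-> side x z) <-> 0 < dot (y - x) (z - x) }.

End SidesDef.

Section Sides.
Context {R : realType} {N : nat} (E : set 'rV[R]_N) (D : R) (p0 q0 : 'rV[R]_N).
Context (E_conn : connected E) (E_nc : nearly_collinear E)
  (ED : forall x y, E x -> E y -> enorm (x - y) <= D)
  (Ep0 : E p0) (Eq0 : E q0) (p0q0 : 2 * D < 3 * enorm (p0 - q0)).
Implicit Types (x y z p q u : 'rV[R]_N).

Let D_gt0 : 0 < D.
Proof. by have := ED Ep0 Eq0; have := p0q0; lra. Qed.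

(** [E] meets the spheres of radius at most [D / 3] centered on it. *)
Lemma reach x (t : R) : E x -> 0 < t -> 3 * t <= D ->
  exists2 y, E y & enorm (x - y) = t.
Proof.
move=> Ex t0 tD; apply: contrapT => nex.
have near_x y : E y -> enorm (x - y) < t.
  move: y; apply: (connected_locally_constant E_conn) => [y Ey|]; last first.
    by exists x => //; rewrite subrr enorm0.
  have [yt|yt|yt] := ltrgtP (enorm (x - y)) t.
  - exists (t - enorm (x - y)); first lra.
    by move=> z _ yz; split => // _; have := triangle x y z; lra.
  - exists (enorm (x - y) - t); first lra.
    move=> z _ yz; split => //; have := triangle x z y; rewrite (enormB z); lra.
  - by exfalso; apply: nex; exists y.
have := triangle p0 x q0; rewrite (enormB p0 x).
by have := near_x _ Ep0; have := near_x _ Eq0; have := p0q0; lra.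
Qed.

(** The dyadic scales. *)
Let rad (k : nat) : R := D / 3 * (1 / 2 ^+ k).

Let rad_gt0 k : 0 < rad k.
Proof. by rewrite mulr_gt0 ?divr_gt0 ?exprn_gt0. Qed.

Let radS k : rad k = 2 * rad k.+1.
Proof.
by rewrite /rad exprS; field; rewrite expf_neq0// pnatr_eq0.
Qed.

Let rad0 : 3 * rad 0 = D.
Proof. by rewrite /rad expr0; field. Qed.

Let rad_le k j : (k <= j)%N -> rad j <= rad k.
Proof.
move=> /subnK <-; elim: (j - k)%N => [|m]//; apply: le_trans.
by rewrite addSn (radS (m + k)); have := rad_gt0 (m + k).+1; lra.
Qed.

Let pt x k : 'rV[R]_N := xget x [set y | E y /\ enorm (x - y) = rad k].

Let ptP x k : E x -> E (pt x k) /\ enorm (x - pt x k) = rad k.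
Proof.
move=> Ex; have [||y Ey xy] := @reach x (rad k) Ex; first exact: rad_gt0.
  by have := @rad_le 0 k (leq0n k); have := rad0; lra.
by rewrite /pt; case: xgetP => [z ->//|/(_ y)]; case; split.
Qed.

(** [dir x k] is a vector of length comparable to [rad k] along [E] near
    [x]; the orientation is carried from the whole of [E] down the scales. *)
Let dir x := fix dir k : 'rV[R]_N :=
  if k is k'.+1 then
    if 0 < dot (pt x k - x) (dir k') then pt x k - x else x - pt x k
  else q0 - p0.

Let dir_segment x k : E x -> exists y z, [/\ E y, E z, dir x k = z - y,
  enorm (x - y) <= 3 * rad k & enorm (x - z) <= 3 * rad k /\ rad k <= enorm (y - z)].
Proof.
move=> Ex; case: k => [|k].
  exists p0, q0; rewrite !rad0; split => //; [exact: ED|].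
  by split; [exact: ED|have := rad0; have := p0q0; have := D_gt0; lra].
have [Epk xpk] := ptP k.+1 Ex; have := rad_gt0 k.+1 => k0.
rewrite /=; case: ifP => _.
  exists x, (pt x k.+1); rewrite subrr enorm0 xpk; split => //; first lra.
  by split; lra.
exists (pt x k.+1), x; rewrite subrr enorm0 (enormB _ x) xpk; split => //; first lra.
by split; lra.
Qed.

Let dirS x k : E x ->
  dot (dir x k) (dir x k) * dot (dir x k.+1) (dir x k.+1) <
    2 * dot (dir x k) (dir x k.+1) ^+ 2.
Proof.
move=> Ex; have [y [z [Ey Ez -> xy [xz yz]]]] := dir_segment k Ex.
have [y' [z' [Ey' Ez' -> xy' [xz' yz']]]] := dir_segment k.+1 Ex.
have := radS k; have := rad_gt0 k.+1 => k0 kS.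
by apply: (E_nc (x := x) (r := 3 * rad k)) => //; lra.
Qed.

Let dir_gt0 x k : E x -> 0 < dot (dir x k) (dir x k.+1).
Proof.
move=> Ex; rewrite lt_neqAle; apply/andP; split.
  apply/eqP => dot0; have := dirS k Ex.
  by rewrite -dot0; have := mulr_ge0 (dot_ge0 (dir x k)) (dot_ge0 (dir x k.+1)); lra.
rewrite dotC /=; case: ifP => [/ltW//|/negbT]; rewrite -leNgt.
by rewrite -(opprB (pt _ _)) dotNl oppr_ge0.
Qed.

(** The scales at which the side of a point at distance [t] can be read. *)
Let cmp k (t : R) := rad k <= 16 * t /\ t <= 16 * rad k.

Let dir_nc x z k : E x -> E z -> cmp k (enorm (x - z)) ->
  dot (dir x k) (dir x k) * dot (z - x) (z - x) < 2 * dot (dir x k) (z - x) ^+ 2.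
Proof.
move=> Ex Ez [kt tk]; have [y' [z' [Ey' Ez' -> xy [xz yz]]]] := dir_segment k Ex.
have := rad_gt0 k => k0.
pose r := Num.max (3 * rad k) (enorm (x - z)).
have [rk rt] : 3 * rad k <= r /\ enorm (x - z) <= r.
  by rewrite !le_max !lexx orbT.
have [rk' rt'] : r <= 50 * rad k /\ r <= 50 * enorm (x - z).
  by rewrite !ge_max; split; apply/andP; split; lra.
by apply: (E_nc (x := x) (r := r)); rewrite ?subrr ?enorm0 //; lra.
Qed.

Let dir_sign x z k j : E x -> E z -> cmp k (enorm (x - z)) ->
  cmp j (enorm (x - z)) -> (0 < dot (z - x) (dir x k)) = (0 < dot (z - x) (dir x j)).
Proof.
wlog kj : k j / (k <= j)%N.
  by move=> wl Ex Ez ck cj; case/orP: (leq_total k j) => kj; [|apply/esym]; exact: wl.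
move=> Ex Ez [kt tk].
move/subnK: kj => <-; elim: (j - k)%N => [|m IH] // [_ jt].
rewrite addSn in jt *.
have mk : rad (m + k) <= rad k by apply: rad_le; rewrite leq_addl.
have := radS (m + k); have := rad_gt0 (m + k).+1 => m0 mS.
rewrite {}IH; last by split; lra.
have cS : cmp (m + k).+1 (enorm (x - z)) by split; lra.
have := tri_sign (dirS (m + k) Ex) (dir_nc Ex Ez cS).
rewrite !(dotC (z - x)) -mulrA pmulr_rgt0; last exact: dir_gt0.
move=> prod; apply/idP/idP => [h|h].
  by move: prod; rewrite pmulr_lgt0.
by move: prod; rewrite pmulr_rgt0.
Qed.

(** [z] lies on the side of [x] to which the vectors [dir x k] point. *)
Definition right x z : Prop := exists2 k, cmp k (enorm (x - z)) &
  0 < dot (z - x) (dir x k).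

Let rightE x z k : E x -> E z -> cmp k (enorm (x - z)) ->
  right x z <-> 0 < dot (z - x) (dir x k).
Proof.
move=> Ex Ez ck; split => [[j cj]|]; last by exists k.
by rewrite (@dir_sign x z j k).
Qed.

Let scale_of x z : E x -> E z -> x <> z ->
  exists k, rad k <= enorm (x - z) /\ enorm (x - z) <= 3 * rad k.
Proof.
move=> Ex Ez xz; have t0 := enorm_gt0 xz.
have ex : exists k, rad k <= enorm (x - z).
  have [k kt] := pow2_small (divr_gt0 t0 D_gt0); exists k.
  move: kt; rewrite ltr_pdivlMr// => kt; have := rad_gt0 k.
  by rewrite /rad; lra.
case: (ex_minnP ex) => k kt kmin; exists k; split => //.
case: k => [|k] in kt kmin *; first by rewrite rad0 ED.
rewrite leNgt; apply/negP => tk; have := rad_gt0 k.+1; have := radS k => kS k0.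
have : (k.+1 <= k)%N by apply: kmin; lra.
by rewrite ltnn.
Qed.

Lemma right_irrefl x : ~ right x x.
Proof.
move=> [k [kt _] _]; move: kt; rewrite subrr enorm0 mulr0.
by have := rad_gt0 k; lra.
Qed.

(** Whether two points are on the same side of a third one is visible from
    the angle, provided that their distances to it are comparable. *)
Lemma right_dot x y z : E x -> E y -> E z -> x <> y ->
  enorm (x - y) <= 4 * enorm (x - z) -> enorm (x - z) <= 4 * enorm (x - y) ->
  (right x y <-> right x z) <-> 0 < dot (y - x) (z - x).
Proof.
move=> Ex Ey Ez xy yz zy; have nc := nearly_collinear3 E_nc Ex Ey Ez xy yz zy.
have [k [ky yk]] := scale_of Ex Ey xy; have k0 := rad_gt0 k.
have cy : cmp k (enorm (x - y)) by split; lra.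
have cz : cmp k (enorm (x - z)) by split; lra.
rewrite (rightE Ex Ey cy) (rightE Ex Ez cz).
have ncy := dir_nc Ex Ey cy.
have := tri_sign ncy nc; rewrite !(dotC _ (dir x k)) mulrAC.
move: (dot (dir x k) (y - x)) (dot (dir x k) (z - x)) (dot (y - x) (z - x)) => a b c.
move=> abc; split => [ab|c0]; last first.
  by move: abc; rewrite pmulr_lgt0// => ab; split => h; nra.
suff ab0 : 0 <= a * b by move: abc; nra.
have [a0|a0] := ltP 0 a; first by have := ab.1 a0 => b0; nra.
have [b0|b0] := ltP 0 b; first by have := ab.2 b0; lra.
nra.
Qed.

Let right_top x y : E x -> E y -> D <= 12 * enorm (x - y) ->
  [/\ right x y <-> 0 < dot (y - x) (q0 - p0) & dot (y - x) (q0 - p0) != 0].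
Proof.
move=> Ex Ey xy; have := ED Ex Ey => xyD.
have c0 : cmp 0 (enorm (x - y)) by have := rad0; split; lra.
split; first exact: (rightE Ex Ey c0).
apply/eqP => dot0; have := dir_nc Ex Ey c0; rewrite (dotC _ (y - x)) dot0 expr0n mulr0.
by have := mulr_ge0 (dot_ge0 (dir x 0)) (dot_ge0 (y - x)); lra.
Qed.

(** Induction down the scales: close points [x'] and [y'] are compared with a
    point [z] three times farther away. *)
Lemma right_antisym x y : E x -> E y -> x <> y -> (right x y <-> ~ right y x).
Proof.
have top x' y' : E x' -> E y' -> D <= 12 * enorm (x' - y') ->
    (right x' y' <-> ~ right y' x').
  move=> Ex Ey xy; have [-> xy0] := right_top Ex Ey xy.
  rewrite enormB in xy; have [-> _] := right_top Ey Ex xy.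
  rewrite -(opprB y' x') dotNl oppr_gt0.
  by split => [h1 h2|/negP]; [lra|rewrite -leNgt le_eqVlt eq_sym (negbTE xy0)].
suff main n x' y' : E x' -> E y' -> D <= 12 * 2 ^+ n * enorm (x' - y') ->
    (right x' y' <-> ~ right y' x').
  move=> Ex Ey /enorm_gt0 xy0; have [n nxy] := pow2_small (divr_gt0 xy0 D_gt0).
  apply: (main n) => //; move: nxy; rewrite ltr_pdivlMr// mul1r mulrC ltr_pdivrMr ?exprn_gt0//.
  by have := mulr_gt0 xy0 (exprn_gt0 n (ltr0Sn R 1)); lra.
elim: n x' y' => [|n IH] x' y' Ex Ey; first by rewrite expr0 mulr1; exact: top.
rewrite exprS => nxy; have [|xyD] := leP D (12 * enorm (x' - y')); first exact: top.
have xy0 : 0 < enorm (x' - y').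
  have : 0 < 12 * (2 * 2 ^+ n) * enorm (x' - y') by exact: lt_le_trans nxy.
  by rewrite pmulr_rgt0// !mulr_gt0// exprn_gt0.
have xy : x' <> y' by move=> xy; move: xy0; rewrite xy subrr enorm0 ltxx.
have [||z Ez xz] := @reach x' (3 * enorm (x' - y')) Ex; [lra|lra|].
have yz1 := triangle y' x' z; have yz2 := triangle x' y' z; rewrite (enormB y' x') in yz1.
have n0 : 0 < 2 ^+ n :> R by rewrite exprn_gt0.
have hx := IH x' z Ex Ez _; have hy := IH y' z Ey Ez _.
have {}hx : right x' z <-> ~ right z x' by apply: hx; rewrite xz; nra.
have {}hy : right y' z <-> ~ right z y' by apply: hy; nra.
have cx := @right_dot x' y' z Ex Ey Ez xy _ _.
have {}cx : (right x' y' <-> right x' z) <-> 0 < dot (y' - x') (z - x') by apply: cx; lra.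
have cy := @right_dot y' x' z Ey Ex Ez (nesym xy) _ _.
have {}cy : (right y' x' <-> right y' z) <-> 0 < dot (x' - y') (z - y').
  by apply: cy; rewrite (enormB y' x'); lra.
have zx : z <> x' by move=> zx; move: xz; rewrite zx subrr enorm0; lra.
have cz := @right_dot z x' y' Ez Ex Ey zx _ _.
have {}cz : (right z x' <-> right z y') <-> 0 < dot (x' - z) (y' - z).
  by apply: cz; rewrite !(enormB z); lra.
have dz : 0 < dot (x' - z) (y' - z).
  rewrite dot_cosine (enormB x' z) (enormB z) xz exprMn.
  by have := sqr_ge0 (enorm (y' - z)); have := exprn_gt0 2 xy0; lra.
have nc := @nearly_collinear3 _ _ E x' y' z E_nc Ex Ey Ez xy _ _.
have {}nc : dot (y' - x') (y' - x') * dot (z - x') (z - x') <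
  2 * dot (y' - x') (z - x') ^+ 2 by apply: nc; lra.
have sum := dot_swap x' y' z.
have opp : 0 < dot (y' - x') (z - x') <-> ~ 0 < dot (x' - y') (z - y').
  rewrite !dot_enorm -!(enormB x') xz exprMn in nc.
  have X0 := exprn_gt0 2 xy0.
  move: nc sum X0; move: (enorm (x' - y') ^+ 2) (dot _ _) (dot _ _) => X a b.
  move=> nc sum X0; split => [a0 b0|/negP]; first by nra.
  by rewrite -leNgt; lra.
exact: side_switch (cz.2 dz) opp cx cy hx hy.
Qed.

Lemma exists_sides : exists side : 'rV[R]_N -> 'rV[R]_N -> Prop, sides E side.
Proof.
exists right; split; [exact: right_irrefl|exact: right_antisym|exact: right_dot].
Qed.

End Sides.

(** * The order *)

Lemma lt_of_sqr (R : realType) (X a : R) : 0 < a -> 0 < X ->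
  X / 2 ^+ 2 * X < 2 * a ^+ 2 -> X < 4 * a.
Proof. by move=> a0 X0 Xa; have [//|aX] := ltP X (4 * a); nra. Qed.

Lemma lt_near (R : realType) (t a b : R) :
  `|a - b| < `|a - t| -> (t < b) = (t < a).
Proof.
rewrite ltr_norml => /andP[]; have [ta|ta] := ltrP t a.
  by move=> ? ?; apply/idP; lra.
by move=> ? ?; apply/negbTE; rewrite -leNgt; lra.
Qed.

Lemma enorm_dist (R : realType) (N : nat) (x y z : 'rV[R]_N) :
  `|enorm (x - y) - enorm (x - z)| <= enorm (y - z).
Proof.
by rewrite ler_norml; have := triangle x y z; have := triangle x z y; rewrite (enormB z); lra.
Qed.

Section Order.
Context {R : realType} {N : nat} (E : set 'rV[R]_N)
  (side : 'rV[R]_N -> 'rV[R]_N -> Prop).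
Context (E_conn : connected E) (E_nc : nearly_collinear E) (E_side : sides E side).
Implicit Types (x y z p q u : 'rV[R]_N).

(* The order is [side] itself: [side p q] says that [q] comes after [p]. *)

Let irrefl := side_irrefl E_side.
Let antisym := side_antisym E_side.

Let near x y z : E x -> E y -> E z -> 2 * enorm (y - z) < enorm (x - y) ->
  (side x y <-> side x z).
Proof.
move=> Ex Ey Ez yz; have yz0 := enorm_ge0 (y - z).
have xy : x <> y by move=> xy; move: yz; rewrite xy subrr enorm0; lra.
have := triangle x y z; have := triangle x z y; rewrite (enormB z y) => h1 h2.
apply/(side_dot E_side) => //; [lra|lra|].
rewrite dot_cosine !(enormB _ x).
have xz : enorm (x - y) ^+ 2 <= 4 * enorm (x - z) ^+ 2.
  by have := enorm_ge0 (x - z); nra.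
have : 4 * enorm (y - z) ^+ 2 < enorm (x - y) ^+ 2 by nra.
have := sqr_ge0 (enorm (y - z)); nra.
Qed.

Let near_l x y z : E x -> E y -> E z -> 2 * enorm (y - z) < enorm (x - y) ->
  (side y x <-> side z x).
Proof.
move=> Ex Ey Ez yz; have yz0 := enorm_ge0 (y - z).
have yx : y <> x by move=> yx; move: yz yz0; rewrite yx subrr enorm0; lra.
have zx : z <> x by move=> zx; move: yz yz0; rewrite zx (enormB y x); lra.
by rewrite (antisym Ey Ex yx) (antisym Ez Ex zx) (near Ex Ey Ez yz).
Qed.

(** Away from [p] and [q], lying between them is a locally constant property. *)
Let between_locally_constant p q u : E p -> E q -> E u -> u <> p -> u <> q ->
  exists2 e : R, 0 < e & forall y, E y -> enorm (u - y) < e ->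
    (side p u /\ side u q <-> side p y /\ side y q).
Proof.
move=> Ep Eq Eu /nesym/enorm_gt0 up /nesym/enorm_gt0 uq.
exists (Num.min (enorm (p - u)) (enorm (q - u)) / 2).
  by rewrite divr_gt0// lt_min up.
move=> y Ey; rewrite ltr_pdivlMr// lt_min => /andP[uyp uyq].
by rewrite (@near p u y)// ?(@near_l q u y)//; lra.
Qed.

(** If [side z x] held, the points between [y] and [x] would form a nonempty
    open and closed subset of [E] that does not contain [x]. *)
Lemma side_trans x y z : E x -> E y -> E z -> side x y -> side y z -> side x z.
Proof.
move=> Ex Ey Ez xy yz.
have nxy : x <> y by move=> xy'; move: xy; rewrite xy'; exact: irrefl.
have nyx : ~ side y x by exact/(antisym Ex Ey nxy).
have d0 := enorm_gt0 nxy.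
have [zx|zx] := pselect (x = z); first by move: yz; rewrite -zx.
apply: contrapT => nxz.
have {nxz zx}zx : side z x by apply: contrapT => /(antisym Ex Ez zx).
suff : side y x /\ side x x by case=> _ /irrefl.
apply: (@connected_locally_constant _ _ E
  (fun u => side y u /\ side u x) E_conn _ (ex_intro2 _ _ z Ez (conj yz zx)) x Ex).
move=> u Eu; have [->|ux] := pselect (u = x).
  exists (enorm (x - y) / 2); first by rewrite divr_gt0.
  move=> v Ev; rewrite ltr_pdivlMr// => xv; split => [[yv _]|[]//].
  by exfalso; apply: nyx; apply/(@near y x v) => //; rewrite (enormB y); lra.
have [->|uy] := pselect (u = y).
  exists (enorm (x - y) / 2); first by rewrite divr_gt0.
  move=> v Ev; rewrite ltr_pdivlMr// => yv; split => [[_ vx]|[/irrefl]//].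
  by exfalso; apply: nyx; apply/(@near_l x y v) => //; lra.
by have [e e0 ev] := between_locally_constant Ey Ex Eu uy ux; exists e => // v Ev /(ev v Ev)[].
Qed.

(** On the side of [p] that contains [q], all positive distances to [p] less
    than that of [q] occur. *)
Lemma reach_side p q (t : R) : E p -> E q -> side p q -> 0 < t ->
  t < enorm (p - q) -> exists x, [/\ E x, side p x & enorm (p - x) = t].
Proof.
move=> Ep Eq pq t0 tpq; apply: contrapT => nex.
suff [/irrefl] : side p p /\ t < enorm (p - p) by [].
apply: (@connected_locally_constant _ _ E
  (fun u => side p u /\ t < enorm (p - u)) E_conn _ (ex_intro2 _ _ q Eq (conj pq tpq)) p Ep).
move=> u Eu; have [->|up] := pselect (u = p).
  by exists t => // y Ey py; split => [[]|[/irrefl]]//; lra.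
have pu0 : 0 < enorm (p - u) by apply: enorm_gt0 => /esym.
have [rpu|nrpu] := pselect (side p u); last first.
  exists (enorm (p - u) / 2); first by rewrite divr_gt0.
  move=> y Ey; rewrite ltr_pdivlMr// => uy.
  have uyp : side p u <-> side p y by apply: near => //; lra.
  by split=> -[h _]; exfalso; apply: nrpu => //; exact/uyp.
have tu : enorm (p - u) - t != 0.
  by rewrite subr_eq0; apply/eqP => put; apply: nex; exists u.
exists (Num.min (enorm (p - u) / 2) `|enorm (p - u) - t|).
  by rewrite lt_min divr_gt0//= normr_gt0.
move=> y Ey; rewrite lt_min ltr_pdivlMr// => /andP[uy uyt].
rewrite -(@near p u y)//; last lra.
by rewrite (lt_near (le_lt_trans (enorm_dist p u y) uyt)).
Qed.

(** Between two points there is a ball whose radius is comparable to their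
    distance; its center [x] is at half that distance from [p]. *)
Lemma side_middle_ball p q : E p -> E q -> side p q ->
  exists2 x, E x & forall y, E y -> 8 * enorm (x - y) < enorm (p - q) ->
    side p y /\ side y q.
Proof.
move=> Ep Eq pq.
have pq' : p <> q by move=> pq'; move: pq; rewrite pq'; exact: irrefl.
have d0 := enorm_gt0 pq'.
have [||x [Ex px pxd]] := @reach_side p q (enorm (p - q) / 2) Ep Eq pq; [lra|lra|].
have px' : p <> x by move=> px'; move: pxd; rewrite px' subrr enorm0 -px'; lra.
have [c1 _] := @side_dot _ _ _ _ E_side p x q Ep Ex Eq px' ltac:(lra) ltac:(lra).
have {}c1 : 0 < dot (x - p) (q - p) by exact: c1.
have nc : dot (x - p) (x - p) * dot (q - p) (q - p) < 2 * dot (x - p) (q - p) ^+ 2.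
  by apply: (nearly_collinear3 E_nc) => //; lra.
have xq2 := dot_cosine p x q; rewrite -!(enormB p) in xq2.
rewrite !dot_enorm -!(enormB p) pxd expr_div_n in nc.
have c3 : enorm (p - q) ^+ 2 < 4 * dot (x - p) (q - p).
  by apply: lt_of_sqr nc => //; exact: exprn_gt0.
have xq_ge := triangle p x q.
have xq_le : enorm (x - q) <= enorm (p - q).
  rewrite -(@ler_pXn2r _ 2) ?nnegrE ?enorm_ge0//.
  by move: xq2; rewrite pxd expr_div_n; lra.
have qx : q <> x by move=> qx; move: pxd; rewrite -qx; lra.
have c2 : side q x <-> side q p.
  apply: (@side_dot _ _ _ _ E_side q x p Eq Ex Ep qx _ _).2.
  - by rewrite !(enormB q); lra.
  - by rewrite !(enormB q); lra.
  rewrite dot_cosine (enormB x p) pxd expr_div_n.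
  by have := sqr_ge0 (enorm (x - q)); have := exprn_gt0 2 d0; lra.
have xq : side x q.
  apply/(antisym Ex Eq (nesym qx)) => /c2.
  exact: (antisym Ep Eq pq').1.
exists x => // y Ey xy; split.
  by apply/(@near p x y) => //; lra.
by apply/(@near_l q x y) => //; rewrite (enormB q x); lra.
Qed.

(** The points between [p] and [q] at distance more than [3 * enorm (p - q)]
    from [p] form an open and closed set: on the sphere of that radius about
    [p], the points after [p] are also after [q]. *)
Lemma side_interval p q y : E p -> E q -> E y -> side p y -> side y q ->
  enorm (p - y) <= 3 * enorm (p - q).
Proof.
move=> Ep Eq Ey py yq; have pq := side_trans Ep Ey Eq py yq.
have npq : p <> q by move=> npq; move: pq; rewrite npq; exact: irrefl.
have nqp : ~ side q p by exact/(antisym Ep Eq npq).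
have d0 := enorm_gt0 npq.
rewrite leNgt; apply/negP => far.
suff [[/irrefl]] : (side p p /\ side p q) /\ 3 * enorm (p - q) < enorm (p - p) by [].
apply: (@connected_locally_constant _ _ E (fun u => (side p u /\ side u q) /\
  3 * enorm (p - q) < enorm (p - u)) E_conn _
  (ex_intro2 _ _ y Ey (conj (conj py yq) far)) p Ep).
move=> u Eu; have [up|up] := pselect (u = p).
  rewrite up; exists (enorm (p - q)) => // v Ev pv; split => [[_]|[[/irrefl]]//]; lra.
have [uq|uq] := pselect (u = q).
  rewrite uq; exists (enorm (p - q)) => // v Ev qv; have := triangle p q v.
  by move=> pqv; split => [[_]|[_]]; lra.
have [e e0 ev] := between_locally_constant Ep Eq Eu up uq.
have [put|put] := eqVneq (enorm (p - u)) (3 * enorm (p - q)); last first.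
  exists (Num.min e `|enorm (p - u) - 3 * enorm (p - q)|).
    by rewrite lt_min e0 normr_gt0 subr_eq0.
  move=> v Ev; rewrite lt_min => /andP[/(ev v Ev) <- uv].
  by rewrite (lt_near (le_lt_trans (enorm_dist p u v) uv)).
suff no : ~ (side p u /\ side u q).
  by exists e => // v Ev /(ev v Ev) uv; split => [[/uv]|[]].
move=> [pu uq'].
have nup : p <> u by exact/nesym.
have c1 : 0 < dot (u - p) (q - p).
  by apply/(side_dot E_side Ep Eu Eq nup) => //; rewrite put; lra.
have nc : dot (u - p) (u - p) * dot (q - p) (q - p) < 2 * dot (u - p) (q - p) ^+ 2.
  by apply: (nearly_collinear3 E_nc) => //; lra.
have sum := dot_swap p q u; rewrite (dotC (q - p)) in sum.
rewrite !dot_enorm -!(enormB p) put exprMn in nc.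
have c2 : ~ 0 < dot (p - q) (u - q).
  move: nc sum c1 (exprn_gt0 2 d0); move: (enorm (p - q) ^+ 2) (dot _ _) (dot _ _) => X a b.
  by move=> *; nra.
have t1 := triangle p q u; have t2 := triangle q p u.
rewrite (enormB q p) in t2.
apply: c2; apply/(side_dot E_side Eq Ep Eu (nesym npq)).
- by rewrite (enormB q p); lra.
- by rewrite (enormB q p); lra.
have nqu : ~ side q u by exact/(antisym Eu Eq uq).
by split.
Qed.

End Order.

(** * Parametrization by measure *)

Section Parametrization.
Context {R : realType} {N : nat} (E : set 'rV[R]_N)
  (side : 'rV[R]_N -> 'rV[R]_N -> Prop) (s c : R).
Context (E_conn : connected E) (E_nc : nearly_collinear E)
  (E_side : sides E side) (E_cpt : compact E) (s_gt0 : 0 < s) (c_gt0 : 0 < c)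
  (E_fin : (hausdorff_measure s E < +oo)%E)
  (E_reg : forall x y z, E x -> E y -> E z -> x <> y ->
    ((c * (enorm (x - y) / 16) `^ s)%:E <=
       hausdorff_measure s (E `&` eball z (enorm (x - y) / 16)))%E).
Implicit Types (x y z p q u : 'rV[R]_N) (A B : set 'rV[R]_N).

Let irrefl := side_irrefl E_side.
Let antisym := side_antisym E_side.

Let nu A : R := fine (hausdorff_measure s (E `&` A)).

Let nuE A : (nu A)%:E = hausdorff_measure s (E `&` A).
Proof.
rewrite fineK// ge0_fin_numE ?hausdorff_ge0//.
by apply: le_lt_trans E_fin; apply: hausdorff_mono; exact: subIsetl.
Qed.

Let nu_mono A B : E `&` A `<=` B -> nu A <= nu B.
Proof.
move=> AB; rewrite -lee_fin !nuE; apply: hausdorff_mono => x [Ex Ax].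
by split => //; exact: AB.
Qed.

Let nuU A B : nu (A `|` B) <= nu A + nu B.
Proof. by rewrite -lee_fin EFinD !nuE setIUr; exact: hausdorffU. Qed.

Let nu_separated (e : R) A B : 0 < e ->
  (forall x y, E x -> E y -> A x -> B y -> e <= enorm (x - y)) ->
  nu A + nu B <= nu (A `|` B).
Proof.
move=> e0 sep; rewrite -lee_fin EFinD !nuE setIUr.
by apply: (hausdorff_separated s_gt0 e0) => x y [Ex Ax] [Ey By]; exact: sep.
Qed.

Let nu_ge0 A : 0 <= nu A.
Proof. by rewrite -lee_fin nuE hausdorff_ge0. Qed.

Let below p : set 'rV[R]_N := [set y | ~ side p y].

(** The measure of the part of [E] up to [p] is the natural parameter. *)
Let phi p := nu (below p).

Let phi_ge p q : E p -> E q -> side p q ->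
  c * (enorm (p - q) / 16) `^ s <= phi q - phi p.
Proof.
move=> Ep Eq pq.
have npq : p <> q by move=> npq; move: pq; rewrite npq; exact: irrefl.
have d0 := enorm_gt0 npq.
have [x Ex ball_x] := side_middle_ball E_conn E_nc E_side Ep Eq pq.
pose B := eball x (enorm (p - q) / 16).
have Bpq y : E y -> B y -> side p y /\ side y q.
  by move=> Ey; rewrite /B /eball /= => xy; apply: ball_x => //; lra.
have : c * (enorm (p - q) / 16) `^ s <= nu B.
  by rewrite -lee_fin nuE; exact: E_reg.
move=> /le_trans; apply; rewrite lerBrDl.
apply: (@le_trans _ _ (nu (below p `|` B))).
  apply: (@nu_separated (enorm (p - q) / 16)) => [|y z Ey Ez py xz].
    by rewrite divr_gt0.
  rewrite leNgt; apply/negP => yz; apply: py; apply: (ball_x y Ey _).1.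
  have := triangle x z y; rewrite (enormB z y).
  by rewrite /B /eball /= in xz; lra.
apply: nu_mono => y [Ey [py|By]]; rewrite /below /= => qy.
  by apply: py; exact: side_trans Ep Eq Ey pq qy.
have [_ yq] := Bpq y Ey By.
have nyq : y <> q by move=> nyq; move: yq; rewrite nyq; exact: irrefl.
exact: (antisym Ey Eq nyq).1 yq qy.
Qed.

Let phi_gt p q : E p -> E q -> side p q -> phi p < phi q.
Proof.
move=> Ep Eq pq; rewrite -subr_gt0; apply: lt_le_trans (phi_ge Ep Eq pq).
rewrite mulr_gt0// powR_gt0// divr_gt0//; apply: enorm_gt0 => npq.
by move: pq; rewrite npq; exact: irrefl.
Qed.

Let total p q : E p -> E q -> p <> q -> side p q \/ side q p.
Proof.
move=> Ep Eq pq; have [|npq] := pselect (side p q); [by left|right].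
by apply: contrapT => nqp; apply: npq; exact/antisym.
Qed.

Let phi_le_ball p q : E p -> E q -> p <> q ->
  `|phi p - phi q| <= nu (ecball p (4 * enorm (p - q))).
Proof.
move=> Ep Eq npq; have d0 := enorm_gt0 npq.
have [pq|qp] := total Ep Eq npq.
  rewrite ltr0_norm ?subr_lt0 ?phi_gt// opprB lerBlDl.
  apply: le_trans (nuU _ _); apply: nu_mono => y [Ey qy].
  have [py|py] := pselect (side p y); [right|by left].
  have [->|nyq] := pselect (y = q); first by rewrite /ecball /=; lra.
  have [//|yq] := total Eq Ey (nesym nyq).
  by have := side_interval E_conn E_nc E_side Ep Eq Ey py yq; rewrite /ecball /=; lra.
rewrite gtr0_norm ?subr_gt0 ?phi_gt// lerBlDl.
apply: le_trans (nuU _ _); apply: nu_mono => y [Ey py].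
have [qy|qy] := pselect (side q y); [right|by left].
have [->|nyp] := pselect (y = p); first by rewrite /ecball /= subrr enorm0 mulr_ge0// ltW.
have [//|yp] := total Ep Ey (nesym nyp).
have := side_interval E_conn E_nc E_side Eq Ep Ey qy yp; have := triangle p q y.
by rewrite /ecball /= (enormB q p); lra.
Qed.

Let phi_continuous p (e : R) : E p -> 0 < e -> exists2 d : R, 0 < d &
  forall q, E q -> enorm (p - q) < d -> `|phi p - phi q| < e.
Proof.
move=> Ep e0; have [r r0 re] := hausdorff_no_atom p s_gt0 e0 E_fin.
exists (r / 4) => [|q Eq]; first by rewrite divr_gt0.
rewrite ltr_pdivlMr// => pqr; have [<-|npq] := pselect (p = q).
  by rewrite subrr normr0.
apply: le_lt_trans (phi_le_ball Ep Eq npq) _.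
rewrite -lte_fin nuE; apply: le_lt_trans re; apply: hausdorff_mono => y [Ey].
by rewrite /ecball /= => py; split => //; rewrite /ecball /=; lra.
Qed.

Let phi_within : {within E, continuous phi}.
Proof.
apply/subspace_continuousP => p Ep; apply/cvgrPdist_lt => e e0.
have [d d0 pd] := phi_continuous Ep e0.
rewrite near_withinE; have : nbhs p (eball p d).
  by apply: open_nbhs_nbhs; split; [exact: eball_open|rewrite /eball /= subrr enorm0].
by apply: filterS => q pq Eq; exact: pd.
Qed.

(* A minimum of [phi] is the first point of [E]. *)
Let E0 : E !=set0 -> exists2 a, E a & phi a = 0.
Proof.
move=> /compact_EVT_min-/(_ _ _ E_cpt phi_within)[a]; rewrite inE => Ea amin.
exists a => //; suff -> : phi a = fine (hausdorff_measure s [set a]).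
  by rewrite hausdorff_null// diam_set1.
congr (fine (hausdorff_measure s _)); apply/seteqP; split => [y [Ey ay]|y ->].
  apply: contrapT => nya; have [//|/(phi_gt Ey Ea)] := total Ea Ey (nesym nya).
  by rewrite ltNge amin// inE.
by split => //; exact: irrefl.
Qed.

(* A maximum of [phi] is the last point of [E]. *)
Let E1 : E !=set0 -> exists2 b, E b & phi b = fine (hausdorff_measure s E).
Proof.
move=> /compact_EVT_max-/(_ _ _ E_cpt phi_within)[b]; rewrite inE => Eb bmax.
exists b => //; congr (fine (hausdorff_measure s _)).
apply/seteqP; split => [y []//|y Ey]; split => // /(phi_gt Eb Ey).
by rewrite ltNge bmax// inE.
Qed.

Let phi_onto (t : R) : E !=set0 -> 0 <= t -> t <= fine (hausdorff_measure s E) ->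
  exists2 x, E x & phi x = t.
Proof.
move=> En t0 t1; apply: contrapT => nex.
have ne x : E x -> phi x <> t by move=> Ex xt; apply: nex; exists x.
have [a Ea a0] := E0 En; have [b Eb b1] := E1 En.
suff : t < phi a by rewrite a0; lra.
apply: (@connected_locally_constant _ _ E (fun u => t < phi u) E_conn _
  (ex_intro2 _ _ b Eb _) a Ea); last first.
  by rewrite b1 lt_neqAle t1 andbT -b1; apply/eqP => /esym; exact: ne.
move=> u Eu; have ut : 0 < `|phi u - t|.
  by rewrite normr_gt0 subr_eq0; apply/eqP; exact: ne.
have [d d0 ud] := phi_continuous Eu ut.
by exists d => // y Ey /(ud y Ey) /lt_near ->.
Qed.

(** A compact connected nearly collinear set with sides, of finite measure and
    such that its intersection with balls of radius [d / 16], where [d] is a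
    distance between two of its points, has measure at least a multiple of
    [d `^ s], is the injective image of a Hoelder continuous map. *)
Lemma holder_parametrization x0 y0 : E x0 -> E y0 -> x0 <> y0 ->
  exists f : R -> 'rV[R]_N, [/\ E = f @` `[0, 1], set_inj `[0, 1] f &
    holder_on `[0, 1] s^-1
      (16 * (fine (hausdorff_measure s E) / c) `^ s^-1) f].
Proof.
move=> Ex0 Ey0 nxy0; have En : E !=set0 by exists x0.
set T := fine (hausdorff_measure s E).
have phiT x : phi x <= T.
  rewrite -lee_fin nuE fineK ?ge0_fin_numE ?hausdorff_ge0//.
  by apply: hausdorff_mono; exact: subIsetl.
have T0 : 0 < T.
  have [/(phi_gt Ex0 Ey0)|/(phi_gt Ey0 Ex0)] := total Ex0 Ey0 nxy0;
    move=> /(le_lt_trans (nu_ge0 _))/lt_le_trans; apply; exact: phiT.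
pose f t := xget x0 [set x | E x /\ phi x = T * t].
have fP t : t \in `[0, 1] -> E (f t) /\ phi (f t) = T * t.
  rewrite in_itv/= => /andP[t0 t1]; have [||x Ex xt] := @phi_onto (T * t) En.
  - by rewrite mulr_ge0// ltW.
  - by rewrite -[leRHS]mulr1 ler_pM2l.
  by apply: (@xgetPex _ x0 [set x | E x /\ phi x = T * t]); exists x.
have phi_inj x y : E x -> E y -> phi x = phi y -> x = y.
  move=> Ex Ey xy; apply: contrapT => nxy.
  by case: (total Ex Ey nxy) => [/(phi_gt Ex Ey)|/(phi_gt Ey Ex)]; rewrite xy ltxx.
exists f; split.
- apply/seteqP; split => [x Ex|_ [t /fP[Ef _] <-]//].
  have t01 : phi x / T \in `[0, 1].
    rewrite in_itv/=; apply/andP; split; first exact: divr_ge0 (nu_ge0 _) (ltW T0).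
    by rewrite ler_pdivrMr// mul1r.
  exists (phi x / T) => //; have [Ef ft] := fP _ t01.
  by apply: phi_inj => //; rewrite ft mulrC divfK// gt_eqF.
- move=> t t' /set_mem /fP[_ ft] /set_mem /fP[_ ft'] ftt'.
  by apply: (mulfI (x := T)); [rewrite gt_eqF|rewrite -ft -ft' ftt'].
move=> t t' /fP[Ef ft] /fP[Ef' ft'].
have [->|nff'] := pselect (f t = f t').
  by rewrite subrr enorm0 mulr_ge0 ?mulr_ge0 ?powR_ge0.
have d0 := enorm_gt0 nff'.
have bound : c * (enorm (f t - f t') / 16) `^ s <= T * `|t - t'|.
  have -> : T * `|t - t'| = `|phi (f t) - phi (f t')|.
    by rewrite ft ft' -mulrBr normrM gtr0_norm.
  case: (total Ef Ef' nff') => [/(phi_ge Ef Ef')|/(phi_ge Ef' Ef)].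
    by move=> /le_trans; apply; rewrite distrC ler_norm.
  by rewrite enormB => /le_trans; apply; rewrite ler_norm.
have Tc0 : 0 <= T / c by rewrite divr_ge0// ltW.
have d16 : 0 <= enorm (f t - f t') / 16 by rewrite divr_ge0// ltW.
rewrite -mulrA -(powRM _ Tc0 (normr_ge0 _)) mulrC -ler_pdivrMr//.
have <- : ((enorm (f t - f t') / 16) `^ s) `^ s^-1 = enorm (f t - f t') / 16.
  by rewrite -powRrM divff ?gt_eqF// powRr1.
apply: ge0_ler_powR; rewrite ?nnegrE ?powR_ge0 ?(mulr_ge0 Tc0)//.
  by rewrite invr_ge0 ltW.
by rewrite mulrAC ler_pdivlMr// mulrC.
Qed.

End Parametrization.

Theorem proposition1p3 (R : realType) :
  exists beta1 : R, [/\ 0 < beta1, beta1 < 1 &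
  forall s : R, 1 < s ->
  exists C : R, 0 < C /\
  forall (N : nat) (E : set 'rV[R]_N) (c : R),
    (0 < diam E)%E ->
    compact E -> connected E ->
    (hausdorff_measure s E < +oo)%E ->
    0 < c -> lower_ahlfors_regular s c E ->
    (forall (x : 'rV[R]_N) (r : R), E x -> 0 < r -> (r%:E <= diam E)%E ->
       (jones_beta E (ecball x r) <= beta1%:E)%E) ->
    exists (f : R -> 'rV[R]_N) (H : R),
      [/\ E = f @` `[0, 1],
          set_inj `[0, 1] f,
          holder_on `[0, 1] s^-1 H f &
          H <= C * (c^-1 * fine (hausdorff_measure s E)
                         * fine (diam E) `^ (1 - s))]].
Proof.
(* The ball of radius [r] has diameter [2 * r], and near collinearity compares
   lengths up to a factor 50: [10 ^- 6] is small enough. *)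
have [b [b0 b1 b_small]] : exists b : R, [/\ 0 < b, b < 1 & 1000 * (1000 * b) <= 1].
  have [i [i0 i1]] : exists i : R, 0 < i /\ 1000 * i = 1.
    by exists (1 / 1000); split; lra.
  exists (i * i); split; first exact: mulr_gt0.
    by rewrite -[ltRHS]mulr1; apply: ltr_pM; rewrite ?ltW//; lra.
  by rewrite (mulrCA 1000 i i) i1 mulr1 i1.
exists b; split => //.
move=> s s1; have s0 : 0 < s by lra.
exists 16; split => // N E c diam0 E_cpt E_conn E_fin c0 E_reg E_flat.
have [M EM] := compact_enorm_bounded E_cpt.
have diamE : (fine (diam E))%:E = diam E.
  rewrite fineK// ge0_fin_numE ?diam_ge0//.
  apply: (@le_lt_trans _ _ (Num.max 0 M)%:E); last exact: ltry.
  by apply: diam_le => [|x y Ex Ey]; rewrite le_max ?lexx ?EM ?orbT.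
set D := fine (diam E) in diamE *.
have D0 : 0 < D by rewrite -lte_fin diamE.
have ED x y : E x -> E y -> enorm (x - y) <= D.
  by move=> Ex Ey; rewrite -lee_fin diamE le_diam_enorm.
have [p0 [q0 [Ep0 Eq0 pq0]]] : exists p0 q0, [/\ E p0, E q0 & 2 * D < 3 * enorm (p0 - q0)].
  have : ((2 * D / 3)%:E < diam E)%E by rewrite -diamE lte_fin; lra.
  rewrite /diam lt_max lte_fin => /orP[|/ereal_sup_gt[_ [p Ep [q Eq <-]]]]; first lra.
  rewrite lte_fin => pq.
  by exists p, q; split => //; lra.
have E_nc : nearly_collinear E.
  apply: (flat_nearly_collinear D0 b0 b_small ED) => x r Ex r0 rD.
  by apply: E_flat => //; rewrite -diamE lee_fin.
have [side E_side] := exists_sides E_conn E_nc ED Ep0 Eq0 pq0.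
set T := fine (hausdorff_measure s E).
have npq : p0 <> q0 by move=> npq; move: pq0; rewrite npq subrr enorm0; lra.
have reg x y z : E x -> E y -> E z -> x <> y ->
    ((c * (enorm (x - y) / 16) `^ s)%:E <=
     hausdorff_measure s (E `&` eball z (enorm (x - y) / 16)))%E.
  move=> Ex Ey Ez nxy; apply: E_reg => //.
    by rewrite divr_gt0// enorm_gt0.
  by rewrite -diamE lee_fin; have := ED x y Ex Ey; have := enorm_ge0 (x - y); lra.
have [f [Ef f_inj f_holder]] := holder_parametrization E_conn E_nc E_side E_cpt s0 c0
  E_fin reg Ep0 Eq0 npq.
exists f, (16 * (T / c) `^ s^-1); split => //.
rewrite ler_pM2l//.
(* The ratio [m] of the measure of [E] to the lower bound given by regularity
   is at least [1], hence bounds its own power of exponent [s^-1]. *)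
have DsT : c * D `^ s <= T.
  rewrite -lee_fin fineK ?ge0_fin_numE ?hausdorff_ge0//.
  apply: (@le_trans _ _ (hausdorff_measure s (E `&` eball p0 D))).
    by apply: E_reg => //; rewrite diamE.
  by apply: hausdorff_mono; exact: subIsetl.
have Ds0 : 0 < D `^ s by exact: powR_gt0.
pose m := T / c / D `^ s.
have m1 : 1 <= m by rewrite /m ler_pdivlMr// mul1r ler_pdivlMr// mulrC.
have Tm : T / c = m * D `^ s by rewrite divfK// gt_eqF.
have -> : c^-1 * T * D `^ (1 - s) = m * D.
  rewrite (mulrC c^-1) Tm powRB; last by apply/implyP => _; rewrite gt_eqF.
  by rewrite powRr1 ?ltW//; field; rewrite gt_eqF.
have m0 : 0 <= m := le_trans ler01 m1.
rewrite Tm (powRM _ m0 (ltW Ds0)) -powRrM divff ?gt_eqF// (powRr1 (ltW D0)).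
rewrite ler_pM2r// -[leRHS](powRr1 m0).
by apply: ler_powR => //; rewrite invf_le1// ltW.
Qed.
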